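(* Let $E_1,\dots,E_{N_B}$ be pairwise distinct real numbers satisfying the non-degeneracy condition at order $p$, let $d_1,\dots,d_{N_B}>0$, and let $\chi(t)=\sum_{j=1}^{N_B}d_je^{-itE_j}$ and $I_k=\overline{|\chi(t)|^{2k}}$. Then for every $k=1,\dots,p$, $$I_k=(k!)^2\sum_{\substack{k_1,\dots,k_{N_B}\ge0\\ k_1+\dots+k_{N_B}=k}}\ \prod_{i=1}^{N_B}\left(\frac{d_i^{k_i}}{k_i!}\right)^2 .$$ Moreover, defining coefficients $a_n$ by the power series $\ln\big(I_0(2\sqrt z)\big)=\sum_{n=1}^\infty a_n\frac{z^n}{n!}$ (where $I_0$ is the modified Bessel function of the first kind) and $X_n:=\sum_{j=1}^{N_B}d_j^{2n}$, one has $$I_p=\sum_{q=1}^{p-1}\binom{p-1}{q-1}\frac{p!}{(p-q)!}\,a_qX_qI_{p-q}+p!\,a_pX_p .$$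
   Context: $\overline{f(t)}:=\lim_{T\to\infty}\frac1T\int_0^Tf(t)\,dt$. Pairwise distinct numbers $E_1,\dots,E_{N_B}$ satisfy the non-degeneracy condition at order $M$ ($M$-ND) if for any sequences $\alpha_i,\beta_i\in\{1,\dots,N_B\}$, $i=1,\dots,M$, the equality $\sum_{j=1}^ME_{\alpha_j}=\sum_{j=1}^ME_{\beta_j}$ implies $\alpha_i=\beta_{\pi(i)}$ for some permutation $\pi\in\mathbb S_M$. $M$-ND implies $N$-ND for $1\le N\le M$. *)

(* Defs.v *)
From HB Require Import structures.
From mathcomp Require Import all_boot all_order all_algebra all_fingroup.
From mathcomp Require Import all_classical all_reals all_analysis.
Set Implicit Arguments. Unset Strict Implicit. Unset Printing Implicit Defensive.
Import Order.TTheory GRing.Theory Num.Theory.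
Import numFieldNormedType.Exports.
Local Open Scope classical_set_scope.
Local Open Scope ring_scope.

Section Defs.
Variable R : realType.

Definition avg_T (f : R -> R) (T : R) : R :=
  T^-1 * Rintegral lebesgue_measure `[0, T] f.

Definition time_avg_to (f : R -> R) (l : R) : Prop :=
  avg_T f @ +oo --> l.

Definition time_avg (f : R -> R) : R := lim (avg_T f @ +oo).

(* |chi(t)|^2 where chi(t) = sum_j d_j e^{-i t E_j}
   = (sum_j d_j cos(-t E_j))^2 + (sum_j d_j sin(-t E_j))^2 *)
Definition chi_abs2 (N : nat) (E d : 'I_N -> R) (t : R) : R :=
  (\sum_(j < N) d j * cos (- (t * E j))) ^+ 2
  + (\sum_(j < N) d j * sin (- (t * E j))) ^+ 2.

Definition Ik (N : nat) (E d : 'I_N -> R) (k : nat) : R :=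
  time_avg (fun t => chi_abs2 E d t ^+ k).

Definition ND (N M : nat) (E : 'I_N -> R) : Prop :=
  forall alpha beta : 'I_M -> 'I_N,
    \sum_(j < M) E (alpha j) = \sum_(j < M) E (beta j) ->
    exists pi : {perm 'I_M}, forall i, alpha i = beta (pi i).

Definition I0_2sqrt (z : R) : R :=
  limn (fun n => \sum_(0 <= m < n) (z ^+ m / (m`!%:R) ^+ 2)).

(* a_n defined by ln(I_0(2 sqrt z)) = sum_{n>=1} a_n z^n / n!,
   i.e. a_n is the n-th derivative at 0 *)
Definition a_coef (n : nat) : R :=
  derive1n n (fun z => ln (I0_2sqrt z)) 0.

Definition X_n (N : nat) (d : 'I_N -> R) (n : nat) : R :=
  \sum_(j < N) d j ^+ (2 * n).

Definition Ik_formula (N : nat) (d : 'I_N -> R) (k : nat) : R :=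
  (k`!%:R) ^+ 2 *
  \sum_(kk : {ffun 'I_N -> 'I_k.+1} | (\sum_(i < N) (kk i : nat) == k)%N)
     \prod_(i < N) (d i ^+ kk i / (kk i)`!%:R) ^+ 2.

End Defs.

(* Main.v *)
Require Import Defs.
From HB Require Import structures.
From mathcomp Require Import all_boot all_order all_algebra all_fingroup.
From mathcomp Require Import all_classical all_reals all_analysis.
From mathcomp Require Import ring.
From mathcomp.real_closed Require Import complex.
Import Order.TTheory GRing.Theory Num.Theory.
Import numFieldNormedType.Exports.
Local Open Scope classical_set_scope.
Local Open Scope ring_scope.

(* Expanding chi(t)^k by the multinomial theorem gives a sum over occupation
   numbers (k_i) of total k, with phases of frequency sum_i k_i E_i.
   Non-degeneracy makes these frequencies pairwise distinct, so that in the time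
   average of |chi|^(2k) only the diagonal terms survive; this is the first
   formula, which says that I_k / (k!)^2 is the coefficient of z^k in
   G(z) = prod_i F(d_i^2 z), with F(z) = I_0(2 sqrt z).  The recursion is the
   coefficient of z^(p-1) in G' = G * sum_i (ln F(d_i^2 z))'.  The power series
   are truncated to polynomials throughout. *)

(** * Taylor polynomials at 0: sums, products, inverses, logarithms *)

Section Jets.
Context {R : realType}.
Implicit Types (f g h : R -> R) (p q : {poly R}).

(* [p] is the Taylor polynomial of [h] at 0 up to order [n]; its coefficients of
   degree above [n] are irrelevant. *)
Fixpoint jet (n : nat) h p : Prop :=
  h 0 = p`_0 /\
  if n is m.+1 then exists2 h' : R -> R,
    (\forall x \near (0 : R), is_derive x (1 : R) h (h' x)) & jet m h' p^`()
  else True.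

Lemma jetS n h p : jet n.+1 h p -> jet n h p.
Proof.
elim: n h p => [|n IHn] h p; first by case.
by case=> h0 [h' dh /IHn jh']; split=> //; exists h'.
Qed.

Lemma jet_near_eq n h g p :
  (\forall x \near (0 : R), h x = g x) -> jet n h p -> jet n g p.
Proof.
move=> hg; case: n => [|n] /= [h0 jh]; split=> //.
- by rewrite -(nbhs_singleton hg).
- by rewrite -(nbhs_singleton hg).
case: jh => h' dh jh'; exists h' => //.
move/near_join: hg => hg.
near=> x; apply: (@near_eq_is_derive _ _ _ h) => //; last by near: x.
by near: x.
Unshelve. all: by end_near. Qed.

(** Links [jet] to the iterated derivatives that define [a_coef]. Since [h'] and [derive1 h] agree
    near 0, a jet of the former is a jet of the latter. *)
Lemma derive1n_jet n h p k :
  jet n h p -> (k <= n)%N -> derive1n k h 0 = p`_k *+ k`!.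
Proof.
elim: n h p k => [|n IHn] h p [|k]; try by case=> h0 *; rewrite derive1n0 h0.
  by [].
case=> h0 [h' dh jh']; rewrite ltnS => kn.
have jd : jet n (derive1 h) p^`().
  apply: jet_near_eq jh'; near=> x.
  have [_ <-] : is_derive x (1 : R) h (h' x) by near: x.
  by rewrite derive1E.
by rewrite derive1Sn (IHn _ _ _ jd) // coef_deriv -mulrnA factS.
Unshelve. all: by end_near. Qed.

Lemma jetD n f g p q : jet n f p -> jet n g q -> jet n (f + g) (p + q).
Proof.
elim: n f g p q => [|n IHn] f g p q; rewrite /= coefD.
  by move=> [<- _] [<- _].
move=> [<- [f' df jf]] [<- [g' dg jg]]; split=> //.
exists (f' + g'); last by rewrite derivD; exact: IHn.
by near=> x; apply: is_deriveD; near: x.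
Unshelve. all: by end_near. Qed.

Lemma jetN n f p : jet n f p -> jet n (- f) (- p).
Proof.
elim: n f p => [|n IHn] f p; rewrite /= coefN; first by move=> [<- _].
move=> [<- [f' df jf]]; split=> //.
exists (- f'); last by rewrite derivN; exact: IHn.
by near=> x; apply: is_deriveN; near: x.
Unshelve. all: by end_near. Qed.

Lemma jetM n f g p q : jet n f p -> jet n g q -> jet n (f * g) (p * q).
Proof.
elim: n f g p q => [|n IHn] f g p q.
  by move=> [f0 _] [g0 _]; split; rewrite // coef0M -f0 -g0.
move=> jf jg; have jf' := jetS _ _ _ jf; have jg' := jetS _ _ _ jg.
case: jf jg => [f0 [f' df jf]] [g0 [g' dg jg]].
split; first by rewrite coef0M -f0 -g0.
exists (f * g' + g * f'); first by near=> x; apply: is_deriveM; near: x.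
rewrite derivM addrC [_ * q]mulrC.
by apply: jetD; exact: IHn.
Unshelve. all: by end_near. Qed.

Lemma poly_primitive (c : R) q : exists2 p : {poly R}, p`_0 = c & p^`() = q.
Proof.
exists (\poly_(i < (size q).+1) (if i is j.+1 then q`_j / i%:R else c)).
  by rewrite coef_poly.
apply/polyP => i; rewrite coef_deriv coef_poly ltnS.
case: ltnP => [_|/leq_sizeP->//]; last by rewrite mul0rn.
by rewrite -[LHS]mulr_natr divfK// pnatr_eq0.
Qed.

Lemma derive_near_gt0 f (f' : R) :
  is_derive (0 : R) (1 : R) f f' -> f 0 > 0 -> \forall x \near (0 : R), 0 < f x.
Proof.
move=> [df _] f0.
have cf : {for (0 : R), continuous f}.
  by apply: differentiable_continuous; exact/derivable1_diffP.
exact: (cvgr_gt _ cf).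
Qed.

(** Induction on the order: a jet of [1/f] of order [n] gives one of [(1/f)' = - f'/f^2], and a
    primitive of that polynomial serves at order [n+1]. *)
Lemma jetV n f p : 0 < f 0 -> jet n f p ->
  exists q, jet n (fun x => (f x)^-1) q.
Proof.
move=> f0; elim: n p => [|n IHn] p jf.
  by exists (f 0)^-1%:P; rewrite /= coefC.
have [q jq] := IHn _ (jetS _ _ _ jf).
have [_ [f' df jf']] := jf.
have fpos := derive_near_gt0 _ _ (nbhs_singleton df) f0.
have [Q Q0 dQ] := poly_primitive (f 0)^-1 (- (q * q * p^`())).
exists Q; split; first by rewrite Q0.
exists (- ((fun x => (f x)^-1) * (fun x => (f x)^-1) * f')); last first.
  by rewrite dQ; apply: jetN; apply: jetM => //; apply: jetM.
near=> x.
have -> : (- ((fun x => (f x)^-1) * (fun x => (f x)^-1) * f')) x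
   = - (f x) ^- 2 *: f' x.
  by rewrite /GRing.opp /GRing.mul /= -exprVn expr2 -mulNr.
apply: is_deriveV; last by near: x.
by rewrite gt_eqF//; near: x.
Unshelve. all: by end_near. Qed.

Lemma jet_ln n f p : 0 < f 0 -> jet n.+1 f p ->
  exists2 q, jet n.+1 (fun x => ln (f x)) q &
    forall k, (k <= n)%N -> (q^`() * p)`_k = p^`()`_k.
Proof.
move=> f0 jf; have [v jv] := jetV _ _ _ f0 (jetS _ _ _ jf).
have [_ [f' df jf']] := jf.
have fpos := derive_near_gt0 _ _ (nbhs_singleton df) f0.
have [q q0 dq] := poly_primitive (ln (f 0)) (v * p^`()).
have jq : jet n ((fun x => (f x)^-1) * f') q^`() by rewrite dq; exact: jetM.
exists q.
  split; first by rewrite q0.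
  exists ((fun x => (f x)^-1) * f') => //.
  by near=> x; apply: is_derive1_comp; [apply: is_derive1_ln|]; near: x.
(* The function [f'] now has two jets of order [n], given by the polynomials p' and q' p. Both
   encode its derivatives at 0, so their coefficients agree up to degree [n]. *)
have jE : jet n f' (q^`() * p).
  apply: jet_near_eq (jetM _ _ _ _ _ jq (jetS _ _ _ jf)); near=> x.
  rewrite /GRing.mul /= mulrAC mulVf ?mul1r// gt_eqF//; near: x.
  exact: fpos.
move=> k kn; have := derive1n_jet _ _ _ _ jE kn.
rewrite (derive1n_jet _ _ _ _ jf' kn) => /eqP.
rewrite -[X in X == _]mulr_natr -[X in _ == X]mulr_natr (inj_eq (mulIf _)) => [/eqP//|].
by rewrite pnatr_eq0 -lt0n fact_gt0.
Unshelve. all: by end_near. Qed.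
End Jets.

(** * The series of [I_0(2 sqrt z)] and the Taylor coefficients of its logarithm *)

Section Bessel.
Context {R : realType}.
Implicit Types (z : R).

(* [bessel_coef 0] are the coefficients of [I_0(2 sqrt z)]; raising [s] by one
   amounts to differentiating the series. *)
Definition bessel_coef (s m : nat) : R := (m`!%:R * (m + s)`!%:R)^-1.

Definition bessel (s : nat) z : R := limn (pseries (bessel_coef s) z).

Lemma bessel_coef_diffs s : pseries_diffs (bessel_coef s) = bessel_coef s.+1.
Proof.
apply/funext => m; rewrite /pseries_diffs /bessel_coef addSnnS factS natrM.
by rewrite -mulrA invfM mulrA divff ?mul1r// pnatr_eq0.
Qed.

(** Domination by the exponential series of [|z|], because [(m + s)!] is at least 1. *)
Lemma is_cvg_bessel s z : cvgn (pseries (bessel_coef s) z).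
Proof.
apply: normed_cvg.
apply: (series_le_cvg _ _ _ (is_cvg_series_exp_coeff `|z|)) => m /=.
- by [].
- by rewrite /exp_coeff /= divr_ge0.
rewrite /exp_coeff /= normrM normrX mulrC ler_wpM2l//.
rewrite /bessel_coef ger0_norm ?invr_ge0//.
rewrite lef_pV2 ?posrE ?mulr_gt0 ?ltr0n ?fact_gt0//.
by rewrite ler_peMr// ler1n fact_gt0.
Qed.

Lemma is_derive_bessel s z : is_derive z (1 : R) (bessel s) (bessel s.+1 z).
Proof.
rewrite /bessel -bessel_coef_diffs.
(* Any point of modulus greater than that of [z] would serve: the series converge everywhere. *)
apply: (@pseries_snd_diffs _ _ (`|z| + 1)); rewrite ?bessel_coef_diffs;
  try exact: is_cvg_bessel.
by rewrite [ltRHS]ger0_norm ?addr_ge0// ltrDl.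
Qed.

Lemma bessel0 s : bessel s 0 = bessel_coef s 0.
Proof.
(* The partial sum of index 0 is empty; the shift drops it, and what remains is a constant
   sequence. *)
apply/cvg_lim => //; rewrite -cvg_shiftS /=.
apply: cvg_near_cst; near=> n.
rewrite /pseries /series /= big_nat_recl// expr0 mulr1 big1 ?addr0// => i _.
by rewrite expr0n mulr0.
Unshelve. all: by end_near. Qed.

Lemma I0_2sqrtE : @I0_2sqrt R = bessel 0.
Proof.
apply/funext => z; rewrite /I0_2sqrt /bessel /pseries /series /=.
congr (limn _); apply/funext => n; apply: eq_bigr => m _.
by rewrite /bessel_coef addn0 mulrC expr2.
Qed.

Lemma jet_bessel n s (p : {poly R}) :
  (forall m, (m <= n)%N -> p`_m = bessel_coef s m) -> jet n (bessel s) p.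
Proof.
elim: n s p => [|n IHn] s p ps; first by split=> //; rewrite bessel0 ps.
split; first by rewrite bessel0 ps.
exists (bessel s.+1); first by near=> x; exact: is_derive_bessel.
apply: IHn => m mn; rewrite coef_deriv ps//.
by rewrite -bessel_coef_diffs /pseries_diffs mulr_natl.
Unshelve. all: by end_near. Qed.

(* Coefficientwise, [F * (ln F)' = F'] for [F = I_0(2 sqrt z)]. *)
Lemma a_coef_recursion (n : nat) (p : {poly R}) :
  (forall m, (m <= n.+1)%N -> p`_m = (m`!%:R ^+ 2)^-1) ->
  exists2 q : {poly R},
    forall k, (k <= n.+1)%N -> a_coef R k = q`_k *+ k`! &
    forall k, (k <= n)%N -> (q^`() * p)`_k = p^`()`_k.
Proof.
move=> pE.
have jp : jet n.+1 (@I0_2sqrt R) p.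
  by rewrite I0_2sqrtE; apply: jet_bessel => m mn; rewrite pE// /bessel_coef addn0 expr2.
have F0 : 0 < @I0_2sqrt R 0.
  by rewrite I0_2sqrtE bessel0 invr_gt0 mulr_gt0// ltr0n fact_gt0.
have [q jq qp] := jet_ln _ _ _ F0 jp.
by exists q => // k kn; exact: derive1n_jet jq kn.
Qed.
End Bessel.

(** * Coefficients of products of polynomials *)

Section PolynomialProducts.

Lemma coef_prod_poly (K : comNzRingType) N k (c : 'I_N -> nat -> K) :
  (\prod_(i < N) \poly_(m < k.+1) c i m)`_k =
  \sum_(kk : {ffun 'I_N -> 'I_k.+1} | (\sum_(i < N) (kk i : nat) == k)%N)
     \prod_(i < N) c i (kk i).
Proof.
under eq_bigr do rewrite poly_def.
rewrite bigA_distr_bigA coef_sum [RHS]big_mkcond /=.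
apply: eq_bigr => kk _.
by rewrite scaler_prod prodrXr coefZ coefXn eq_sym; case: eqP; rewrite ?mulr1 ?mulr0.
Qed.

(** Agreement up to degree [n] is congruence modulo [X^(n+1)], hence compatible with products. *)
Lemma coefM_eq (K : nzRingType) n (p p' q q' : {poly K}) :
  (forall m, (m <= n)%N -> p`_m = p'`_m) ->
  (forall m, (m <= n)%N -> q`_m = q'`_m) ->
  forall m, (m <= n)%N -> (p * q)`_m = (p' * q')`_m.
Proof.
move=> pp' qq' m mn; rewrite !coefM; apply: eq_bigr => j _.
rewrite pp' ?qq'//; last by rewrite (leq_trans _ mn) ?leq_ord.
by rewrite (leq_trans _ mn) ?leq_subr.
Qed.

Lemma coef_prod_eq (K : nzRingType) n (I : finType) (P Q : I -> {poly K}) :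
  (forall i m, (m <= n)%N -> (P i)`_m = (Q i)`_m) ->
  forall m, (m <= n)%N -> (\prod_i P i)`_m = (\prod_i Q i)`_m.
Proof.
move=> PQ.
pose eqn (p q : {poly K}) := forall m, (m <= n)%N -> p`_m = q`_m.
by apply: (big_ind2 eqn) => [//|p p' q q' pp' qq'|i _]; [apply: coefM_eq|apply: PQ].
Qed.

(** This is [exp(x z) exp(y z) = exp((x + y) z)] for truncated series; coefficientwise it is the
    binomial theorem. *)
Lemma coef_prod_exp (K : numFieldType) (I : finType) n (x : I -> K) k :
  (k < n)%N ->
  (\prod_i \poly_(m < n) (x i ^+ m / m`!%:R))`_k = (\sum_i x i) ^+ k / k`!%:R.
Proof.
pose expn_to (p : {poly K}) s := forall m, (m < n)%N -> p`_m = s ^+ m / m`!%:R.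
move: k; apply: (big_ind2 expn_to).
- by move=> m _; rewrite coef1 expr0n; case: m => [|m]; rewrite ?fact0 ?divr1 ?mul0r.
- move=> p x1 q x2 pE qE m mn.
  rewrite coefM addrC exprDn mulr_suml; apply: eq_bigr => j _.
  have jm : (j <= m)%N by rewrite -ltnS.
  rewrite pE ?(leq_ltn_trans jm)// qE ?(leq_ltn_trans (leq_subr _ _))//.
  rewrite -mulr_natr -(bin_fact jm) !natrM.
  have fact_neq0 l : (l`!)%:R != 0 :> K by rewrite pnatr_eq0 -lt0n fact_gt0.
  have bin_neq0 : ('C(m, j))%:R != 0 :> K by rewrite pnatr_eq0 -lt0n bin_gt0.
  by field; rewrite !fact_neq0 bin_neq0.
- by move=> i _ m mn; rewrite coef_poly mn.
Qed.

(** The coefficient of [z^k] in the product of the truncated [exp(x_i z)], computed in two ways. *)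
Lemma multinomial (K : numFieldType) N k (x : 'I_N -> K) :
  (\sum_i x i) ^+ k = k`!%:R *
  \sum_(kk : {ffun 'I_N -> 'I_k.+1} | (\sum_(i < N) (kk i : nat) == k)%N)
     \prod_(i < N) (x i ^+ kk i / (kk i)`!%:R).
Proof.
rewrite -(@coef_prod_poly _ _ _ (fun i m => x i ^+ m / m`!%:R)).
by rewrite coef_prod_exp// mulrCA divff ?mulr1// pnatr_eq0 -lt0n fact_gt0.
Qed.

Lemma coef_comp_scaleX (K : comNzRingType) (p : {poly K}) (c : K) m :
  (p \Po (c *: 'X))`_m = p`_m * c ^+ m.
Proof.
rewrite comp_polyE coef_sum.
under eq_bigr do rewrite exprZn !coefZ coefXn.
have [mp|pm] := ltnP m (size p).
  rewrite (bigD1 (Ordinal mp)) //= eqxx mulr1 big1 ?addr0// => j jm.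
  by rewrite eq_sym -val_eqE in jm *; rewrite (negPf jm) !mulr0.
rewrite nth_default// mul0r big1// => j _.
by rewrite gtn_eqF ?mulr0// (leq_trans _ pm).
Qed.

(** Logarithmic derivatives add over a product. The relation [A_i P_i = P_i'] modulo [X^(n+1)]
    expresses [A_i = P_i'/P_i] without division, and Leibniz's rule propagates it. *)
Lemma coef_log_deriv_prod (K : comNzRingType) n (I : finType)
    (P A : I -> {poly K}) :
  (forall i k, (k <= n)%N -> (A i * P i)`_k = (P i)^`()`_k) ->
  forall k, (k <= n)%N ->
    ((\sum_i A i) * \prod_i P i)`_k = (\prod_i P i)^`()`_k.
Proof.
move=> AP.
pose log_deriv (a p : {poly K}) := forall m, (m <= n)%N -> (a * p)`_m = p^`()`_m.
apply: (big_ind2 log_deriv) => [m _|a p b q ap bq m mn|i _]; last exact: AP.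
  by rewrite mul0r derivC.
rewrite derivM coefD mulrDl coefD mulrA mulrCA.
by rewrite (@coefM_eq _ n _ p^`() q q)// [in LHS]addrC (@coefM_eq _ n p p _ q^`())// addrC.
Qed.

End PolynomialProducts.

(** * The recursion for the closed formula *)

Lemma Ik_formula_recursion (R : realType) N (d : 'I_N -> R) n :
  Ik_formula d n.+1 =
    \sum_(1 <= q < n.+1)
       ('C(n, q.-1)%:R * (n.+1`!%:R / (n.+1 - q)`!%:R)
          * a_coef R q * X_n d q * Ik_formula d (n.+1 - q))
    + n.+1`!%:R * a_coef R n.+1 * X_n d n.+1.
Proof.
(* [F] truncated at degree [n+1], which determines the coefficients of [G] up to that degree. *)
pose f := \poly_(m < n.+2) (m`!%:R ^+ 2 : R)^-1.
have fE m : (m <= n.+1)%N -> f`_m = (m`!%:R ^+ 2)^-1 by move=> mn; rewrite coef_poly ltnS mn.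
have [q aE qf] := a_coef_recursion _ _ fE.
pose P i := f \Po (d i ^+ 2 *: 'X).
(* As [q] is a Taylor polynomial of [ln F], this stands for the derivative of [ln F(d_i^2 z)]. *)
pose A i := (q \Po (d i ^+ 2 *: 'X))^`().
pose G := \prod_i P i.
have IE k : (k <= n.+1)%N -> Ik_formula d k = k`!%:R ^+ 2 * G`_k.
  move=> kn; rewrite /Ik_formula; congr (_ * _).
  rewrite -(@coef_prod_poly _ _ _ (fun i m => (d i ^+ m / m`!%:R) ^+ 2)).
  apply: (@coef_prod_eq _ k) => // i m mk.
  rewrite coef_poly ltnS mk coef_comp_scaleX fE ?(leq_trans mk)//.
  by rewrite exprMn exprVn mulrC exprAC.
have AE j : (j <= n)%N -> (\sum_i A i)`_j = a_coef R j.+1 / j`!%:R * X_n d j.+1.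
  move=> jn; rewrite coef_sum /X_n mulr_sumr; apply: eq_bigr => i _.
  rewrite coef_deriv coef_comp_scaleX -exprM aE// -[LHS]mulr_natr mulrAC; congr (_ * _).
  rewrite factS -[q`_j.+1 *+ _]mulr_natr natrM.
  by field; rewrite pnatr_eq0 -lt0n fact_gt0.
have APE i k : (k <= n)%N -> (A i * P i)`_k = (P i)^`()`_k.
  move=> kn; rewrite /A /P !deriv_comp mulrAC -comp_polyM derivZ derivX alg_polyC.
  by rewrite !coefMC !coef_comp_scaleX qf.
have := coef_log_deriv_prod _ _ _ _ _ APE n (leqnn n).
rewrite coef_deriv coefM -/G => GE.
have G0 : G`_0 = 1.
  rewrite -horner_coef0 horner_prod big1// => i _.
  by rewrite horner_coef0 coef_comp_scaleX fE// fact0 expr1n invr1 mul1r.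
have natr_fact_neq0 m : (m`!)%:R != 0 :> R by rewrite pnatr_eq0 -lt0n fact_gt0.
rewrite IE// -[LHS]mulr1.
(* Brings out the coefficient of [z^n] in [G'], to be replaced through [GE]. *)
have -> : n.+1`!%:R ^+ 2 * G`_n.+1 * 1 = n.+1`!%:R * n`!%:R * (G`_n.+1 *+ n.+1).
  by rewrite factS -mulr_natr natrM; ring.
(* The top term [j = n] meets [G_0 = 1] and becomes the separate [a_(n+1)] term; the others
   correspond to [q = j + 1]. *)
rewrite -GE big_ord_recr /= subnn G0 AE// mulrDr; congr (_ + _); last first.
  by field; exact: natr_fact_neq0.
rewrite big_add1 /= big_mkord mulr_sumr; apply: eq_bigr => j _.
have jn : (j <= n)%N by rewrite ltnW.
(* The binomial coefficient comes from [n! = C(n,j) j! (n-j)!]. *)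
rewrite subSS AE// IE ?leqW ?leq_subr// -[in n`!](bin_fact jn) !natrM.
by field; rewrite !natr_fact_neq0.
Qed.

(** * Time averages of trigonometric sums *)

Section TimeAverages.
Context {R : realType}.
Implicit Types (f F : R -> R).

Lemma avg_T_primitive f F (T : R) : 0 < T -> continuous f ->
  (forall t, is_derive t (1 : R) F (f t)) -> avg_T f T = T^-1 * (F T - F 0).
Proof.
move=> T0 cf dF; rewrite /avg_T /Rintegral; congr (_ * _).
have cF : continuous F.
  by move=> t; apply: differentiable_continuous; apply/derivable1_diffP; have [] := dF t.
rewrite (@continuous_FTC2 _ f F 0 T T0) //.
- exact: continuous_subspaceT.
- split=> [x _||]; first by have [] := dF x.
  + exact/cvg_at_right_filter/cF.
  + exact/cvg_at_left_filter/cF.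
- by move=> x _; rewrite derive1E; have [_ ->] := dF x.
Qed.

Lemma time_avg_to_ext f g l : f =1 g -> time_avg_to g l -> time_avg_to f l.
Proof. by move=> /funext ->. Qed.

(** The primitive of [cos (t * v)] vanishing at 0. Only the zero frequency has an unbounded
    primitive, so only it survives averaging. *)
Definition cos_primitive (v t : R) : R := if v == 0 then t else sin (t * v) / v.

Lemma is_derive_cos_primitive v t :
  is_derive t (1 : R) (cos_primitive v) (cos (t * v)).
Proof.
rewrite /cos_primitive; case: eqVneq => [->|v0].
  by rewrite mulr0 cos0; exact: is_derive_id.
have -> : (fun t : R => sin (t * v) / v) = v^-1 \*: (sin \o (v \*: id)).
  by apply/funext => s; rewrite /= mulrC [s * v]mulrC.
have := is_deriveZ v^-1 (is_derive1_comp (is_derive_sin _) (is_deriveZ v (is_derive_id t (1 : R)))).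
suff -> : v^-1 *: (cos ((v \*: id) t) * (v *: 1)) = cos (t * v) by [].
by rewrite /GRing.scale /= mulr1 mulrCA mulVf// mulr1 mulrC.
Qed.

Lemma continuous_cosM (v : R) : continuous (fun t : R => cos (t * v)).
Proof.
move=> t; apply: (@cvg_comp _ _ _ (fun s : R => s * v) cos _ (nbhs (t * v))).
  by apply: cvgM; [exact: cvg_id|exact: cvg_cst].
exact: continuous_cos.
Qed.

(** At [v = 0] the quotient is 1 for positive [T]; otherwise [|sin| <= 1] bounds it by
    [1 / (T |v|)]. *)
Lemma cvg_cos_primitive (v : R) :
  T^-1 * cos_primitive v T @[T --> +oo] --> ((v == 0)%:R : R).
Proof.
rewrite /cos_primitive; case: eqVneq => [_|v0].
  apply: cvg_near_cst; near=> T; by rewrite mulVf// gt_eqF.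
have H : T^-1 * `|v|^-1 @[T --> +oo] --> (0 : R).
  rewrite -[X in _ --> X](mul0r `|v|^-1).
  apply: cvgMl; apply/gtr0_cvgV0; last exact: cvg_id.
  exact: nbhs_pinfty_gt (num_real _).
apply: norm_cvg0.
apply: (squeeze_cvgr _ _ H); last exact: cvg_cst.
near=> T.
have T0 : 0 < T by [].
rewrite normr_ge0 /= normrM [X in X * _]ger0_norm ?invr_ge0 ?(ltW T0)//.
rewrite ler_wpM2l ?invr_ge0 ?(ltW T0)// normrM normfV ler_piMl//.
exact: sin_max.
Unshelve. all: by end_near. Qed.

Lemma cvg_sumr (T : Type) (F : set_system T) (I : finType) (Q : pred I)
    (f : I -> T -> R) (l : I -> R) : Filter F ->
  (forall i, Q i -> f i @ F --> l i) ->
  (fun x => \sum_(i | Q i) f i x) @ F --> \sum_(i | Q i) l i.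
Proof. by move=> FF fl; apply: cvg_big => // *; exact: add_continuous. Qed.

Lemma time_avg_to_trig (I : finType) (Q : pred I) (B v : I -> R) :
  time_avg_to (fun t => \sum_(i | Q i) B i * cos (t * v i))
    (\sum_(i | Q i) B i * (v i == 0)%:R).
Proof.
pose f t : R := \sum_(i | Q i) B i * cos (t * v i).
pose F t : R := \sum_(i | Q i) B i * cos_primitive (v i) t.
have cf : continuous f.
  move=> t; apply: cvg_sumr => i _; apply: cvgMr; exact: continuous_cosM.
have dF t : is_derive t (1 : R) F (f t).
  rewrite /F /f.
  pose P (G : R -> R) (g : R) := is_derive t (1 : R) G g.
  have -> : (fun t => \sum_(i | Q i) B i * cos_primitive (v i) t) =
     \sum_(i | Q i) (fun t => B i * cos_primitive (v i) t).
    by apply/funext => s; rewrite fct_sumE.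
  apply: (big_ind2 P) => [|? ? ? ? ? ?|i _].
  - exact: is_derive_cst.
  - exact: is_deriveD.
  - apply: is_deriveZ; exact: is_derive_cos_primitive.
rewrite /time_avg_to -/f.
have F0 : F 0 = 0.
  rewrite /F big1// => i _; rewrite /cos_primitive mul0r sin0 mul0r.
  by case: ifP; rewrite mulr0.
have H : \sum_(i | Q i) B i * (T^-1 * cos_primitive (v i) T) @[T --> +oo] -->
  \sum_(i | Q i) B i * (v i == 0)%:R.
  apply: cvg_sumr => i _; apply: cvgMr; exact: cvg_cos_primitive.
apply: cvg_trans H; apply: near_eq_cvg; near=> T.
rewrite (avg_T_primitive f F)//.
rewrite F0 subr0 /F mulr_sumr; apply: eq_bigr => i _; by rewrite mulrCA.
Unshelve. all: by end_near. Qed.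

(** The squares expand into the double sum of [A_i A_j cos (t (w_i - w_j))]; by injectivity the zero
    frequency occurs only for [i = j]. *)
Lemma time_avg_to_abs2 (I : finType) (Q : pred I) (A w : I -> R) :
  {in Q &, injective w} ->
  time_avg_to (fun t => (\sum_(i | Q i) A i * cos (- (t * w i))) ^+ 2
                      + (\sum_(i | Q i) A i * sin (- (t * w i))) ^+ 2)
    (\sum_(i | Q i) A i ^+ 2).
Proof.
move=> winj.
have := time_avg_to_trig _ (fun ij : I * I => Q ij.1 && Q ij.2)
  (fun ij => A ij.1 * A ij.2) (fun ij => w ij.1 - w ij.2).
rewrite -(pair_big Q Q (fun i j => A i * A j * (w i - w j == 0)%:R)) /=.
have -> : \sum_(i | Q i) \sum_(j | Q j) A i * A j * (w i - w j == 0)%:R =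
          \sum_(i | Q i) A i ^+ 2.
  apply: eq_bigr => i Qi; rewrite (bigD1 i)//= subrr eqxx mulr1 big1 ?addr0//.
  move=> j /andP[Qj ji]; rewrite subr_eq0 (inj_in_eq winj)// eq_sym (negPf ji).
  by rewrite mulr0.
apply: time_avg_to_ext => t.
rewrite -(pair_big Q Q (fun i j => A i * A j * cos (t * (w i - w j)))) /=.
rewrite !expr2 !mulr_suml -big_split; apply: eq_bigr => i _ /=.
rewrite !mulr_sumr -big_split; apply: eq_bigr => j _ /=.
rewrite mulrBr cosB !cosN !sinN; ring.
Qed.

End TimeAverages.

(** * Multinomial expansion of the powers of chi *)

Section Expansion.
Context {R : realType}.
Local Open Scope complex_scope.

Definition expi (x : R) : R[i] := cos x +i* sin x.

Lemma expiD x y : expi (x + y) = expi x * expi y.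
Proof. by rewrite /expi cosD sinD [X in _ +i* X]addrC. Qed.

Lemma expi_sum (I : finType) (x : I -> R) :
  expi (\sum_i x i) = \prod_i expi (x i).
Proof. apply: (big_morph expi expiD); by rewrite /expi cos0 sin0. Qed.

Lemma expiMn x n : expi (x *+ n) = expi x ^+ n.
Proof.
elim: n => [|n IHn]; first by rewrite mulr0n /expi cos0 sin0 expr0.
by rewrite mulrS expiD IHn exprS.
Qed.

Definition abs2 (z : R[i]) : R := complex.Re z ^+ 2 + complex.Im z ^+ 2.

Lemma abs2M z w : abs2 (z * w) = abs2 z * abs2 w.
Proof. case: z w => [a b] [c e]; rewrite /abs2 /=; ring. Qed.

Lemma abs2X z k : abs2 (z ^+ k) = abs2 z ^+ k.
Proof.
elim: k => [|k IHk]; first by rewrite !expr0 /abs2 /= expr1n expr0n addr0.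
by rewrite !exprS abs2M IHk.
Qed.

Lemma abs2_sum (I : finType) (Q : pred I) (A x : I -> R) :
  abs2 (\sum_(i | Q i) (A i)%:C * expi (x i)) =
  (\sum_(i | Q i) A i * cos (x i)) ^+ 2 + (\sum_(i | Q i) A i * sin (x i)) ^+ 2.
Proof.
have -> : \sum_(i | Q i) (A i)%:C * expi (x i) =
   (\sum_(i | Q i) A i * cos (x i)) +i* (\sum_(i | Q i) A i * sin (x i)).
  apply: (big_ind3 (fun z a b => z = a +i* b)) => //.
    by move=> ? ? ? ? ? ? -> ->.
  by move=> i _; rewrite /expi /GRing.mul /= !mul0r subr0 addr0.
by [].
Qed.

(** [|chi|^(2k)] is the squared modulus of [chi^k], expanded multinomially over [R[i]]; the phases
    belonging to [kk] multiply to a single one of frequency [w kk]. *)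
Lemma chi_abs2X N (E d : 'I_N -> R) k t :
  let Q (kk : {ffun 'I_N -> 'I_k.+1}) := (\sum_(i < N) (kk i : nat) == k)%N in
  let A (kk : {ffun 'I_N -> 'I_k.+1}) := k`!%:R * \prod_i (d i ^+ kk i / (kk i)`!%:R) in
  let w (kk : {ffun 'I_N -> 'I_k.+1}) := \sum_i E i *+ kk i in
  chi_abs2 E d t ^+ k =
    (\sum_(kk | Q kk) A kk * cos (- (t * w kk))) ^+ 2
  + (\sum_(kk | Q kk) A kk * sin (- (t * w kk))) ^+ 2.
Proof.
move=> Q A w; rewrite /chi_abs2.
rewrite -(@abs2_sum _ xpredT d (fun j => - (t * E j))) -abs2X multinomial.
rewrite -abs2_sum mulr_sumr; congr abs2; apply: eq_bigr => kk _.
rewrite /A /w rmorphM rmorph_nat -mulrA; congr (_ * _).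
rewrite rmorph_prod mulr_sumr -sumrN expi_sum -big_split; apply: eq_bigr => i _ /=.
rewrite mulrnAr -mulNrn expiMn exprMn rmorphM rmorphXn mulrAC.
congr (_ * _ * _).
by rewrite fmorphV rmorph_nat.
Qed.
End Expansion.

(** * Non-degeneracy in terms of occupation numbers *)

Section NonDegeneracy.
Context {R : realType}.

(** Occupation numbers encode multisets of levels. Listing each level with its multiplicity gives
    sequences of length [p], to which non-degeneracy applies; a permutation preserves
    multiplicities. *)
Lemma ND_occupation_eq N p (E : 'I_N -> R) (kk ll : 'I_N -> nat) :
  ND p E -> (\sum_i kk i)%N = p -> (\sum_i ll i)%N = p ->
  \sum_i E i *+ kk i = \sum_i E i *+ ll i -> kk =1 ll.
Proof.
move=> nd kp lp Ekl.
pose levels (mm : 'I_N -> nat) := flatten [seq nseq (mm i) i | i <- enum 'I_N].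
have size_levels mm : (\sum_i mm i)%N = p -> size (levels mm) == p.
  move=> <-; rewrite size_flatten /shape -map_comp sumnE big_map big_enum /=.
  by apply/eqP; apply: eq_bigr => i _; rewrite size_nseq.
have sum_levels mm (mp : size (levels mm) == p) :
    \sum_(j < p) E (tnth (Tuple mp) j) = \sum_i E i *+ mm i.
  rewrite -(big_tuple _ _ (Tuple mp) xpredT E) /= big_flatten big_map big_enum /=.
  by apply: eq_bigr => i _; rewrite big_nseq -Monoid.iteropE.
have count_levels mm i : count_mem i (levels mm) = mm i.
  rewrite count_flatten -map_comp sumnE big_map big_enum /= (bigD1 i)//=.
  rewrite count_nseq /= eqxx mul1n big1 ?addn0// => j ji.
  by rewrite count_nseq /= (negPf ji).
have [|s sE] := nd (tnth (Tuple (size_levels _ kp))) (tnth (Tuple (size_levels _ lp))).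
  by rewrite !sum_levels.
have /seq.permP kl : perm_eq (levels kk) (levels ll).
  apply/(@tuple_permP _ _ _ (Tuple (size_levels _ lp))); exists s.
  have -> : levels kk = Tuple (size_levels _ kp) by [].
  by congr val; apply: eq_from_tnth => j; rewrite tnth_mktuple.
by move=> i; rewrite -count_levels kl count_levels.
Qed.

Lemma ND_occupation N p k (E : 'I_N -> R) (kk ll : 'I_N -> nat) :
  ND p E -> (k <= p)%N -> (\sum_i kk i)%N = k -> (\sum_i ll i)%N = k ->
  \sum_i E i *+ kk i = \sum_i E i *+ ll i -> kk =1 ll.
Proof.
move=> nd kp kE lE Ekl i0.
(* Order [k] reduces to order [p] by adding [p - k] copies of one level to both sides. The level
   [i0] at which equality is tested is at hand for this. *)
pose pad (mm : 'I_N -> nat) i := (mm i + (i == i0) * (p - k))%N.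
have sum_pad mm : (\sum_i mm i)%N = k -> (\sum_i pad mm i)%N = p.
  move=> mk; rewrite big_split /= mk (bigD1 i0)//= eqxx mul1n big1 ?addn0 ?subnKC//.
  by move=> i /negPf ->.
have E_pad mm : \sum_i E i *+ pad mm i =
    \sum_i E i *+ mm i + \sum_i E i *+ ((i == i0) * (p - k)).
  by rewrite -big_split; apply: eq_bigr => i _; rewrite /= mulrnDr.
have := ND_occupation_eq _ _ _ _ _ nd (sum_pad _ kE) (sum_pad _ lE).
rewrite !E_pad Ekl => /(_ erefl i0) /eqP; by rewrite /pad eqn_add2r => /eqP.
Qed.
End NonDegeneracy.

(** * The moments of chi and their recursion *)

(** By [ND_occupation], distinct configurations of total [k] have distinct frequencies, so the
    average is the sum of the squared amplitudes. *)
Lemma time_avg_to_Ik_formula (R : realType) N p k (E d : 'I_N -> R) :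
  ND p E -> (k <= p)%N ->
  time_avg_to (fun t => chi_abs2 E d t ^+ k) (Ik_formula d k).
Proof.
move=> nd kp; apply: time_avg_to_ext => [t|]; first exact: chi_abs2X.
have -> : Ik_formula d k = \sum_(kk : {ffun 'I_N -> 'I_k.+1} |
     (\sum_(i < N) (kk i : nat) == k)%N)
   (k`!%:R * \prod_i (d i ^+ kk i / (kk i)`!%:R)) ^+ 2.
  rewrite /Ik_formula mulr_sumr; apply: eq_bigr => kk _.
  by rewrite exprMn prodrXl.
apply: time_avg_to_abs2 => kk ll /eqP kE /eqP lE Ekl.
apply/ffunP => i; apply: val_inj.
exact: (ND_occupation _ _ _ _ (fun i => kk i : nat) (fun i => ll i : nat) nd kp kE lE Ekl).
Qed.

Theorem theorem4 (R : realType) (N p : nat) (E d : 'I_N -> R) :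
  (1 <= p)%N ->
  injective E ->
  ND p E ->
  (forall i, 0 < d i) ->
  (forall k : nat, (1 <= k <= p)%N ->
     time_avg_to (fun t => chi_abs2 E d t ^+ k) (Ik_formula d k))
  /\
  Ik E d p =
    \sum_(1 <= q < p)
       ('C(p.-1, q.-1)%:R * (p`!%:R / (p - q)`!%:R)
          * a_coef R q * X_n d q * Ik E d (p - q))
    + p`!%:R * a_coef R p * X_n d p.
Proof.
move=> p_gt0 _ nd _; split=> [k /andP[_ kp]|]; first exact: (time_avg_to_Ik_formula _ _ _ _ _ _ nd kp).
(* [Ik] is defined as a [lim]; convergence identifies its value by uniqueness of limits. *)
have IkE k : (k <= p)%N -> Ik E d k = Ik_formula d k.
  move=> kp; apply/cvg_lim => //. exact: (time_avg_to_Ik_formula _ _ _ _ _ _ nd kp).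
rewrite IkE//; case: p p_gt0 nd IkE => // n _ nd IkE.
rewrite Ik_formula_recursion; congr (_ + _).
by apply: eq_bigr => q _; rewrite IkE// leq_subr.
Qed.
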